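(* Let $\vartheta\ge0$ and let $F:S^1\to\mathbb{C}$ be a continuous function contained in a Sobolev space $H^s$ for some $s>\frac12+(1-\vartheta)_+$. Then there exists $\alpha>(1-\vartheta)_+$ such that $$\sum_{m\in\mathbb{Z}}|m|^\alpha|c_m(F)|<\infty .$$ Consequently, if moreover $c_0(F)=0$ and $(z_j)_{j\ge1}$ are i.i.d. $S^1$-valued random variables, then $$\sum_{k=1}^\infty k^{(1-\vartheta)_+}\,\mathbb{E}[|\Delta_k(F,Z_{k,1})|]<\infty .$$
   Context: $S^1$ is the complex unit circle; $x_+=\max(x,0)$. $c_m(F):=\frac{1}{2\pi}\int_0^{2\pi}e^{-imx}F(e^{ix})\,dx$ for $m\in\mathbb{Z}$; $F\in H^s$ means $\sum_{m\in\mathbb{Z}}|m|^{2s}|c_m(F)|^2<\infty$ (for $F\in L^2$). For $k\ge1$ and $y\in S^1$, $\Delta_k(F,y):=\frac1k\sum_{\omega^k=y}F(\omega)$. $Z_{k,1}$ is a random variable equal in law to $\prod_{j=1}^kz_j$. *)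

(* Defs.v *)
From HB Require Import structures.
From mathcomp Require Export all_boot all_order all_algebra finmap.
From mathcomp Require Export all_classical all_reals all_analysis.
From mathcomp.real_closed Require Export complex.

Set Implicit Arguments.
Unset Strict Implicit.
Unset Printing Implicit Defensive.

Import Order.TTheory GRing.Theory Num.Theory.
Import numFieldNormedType.Exports.
Import ComplexField.

Local Open Scope classical_set_scope.
Local Open Scope ring_scope.
Local Open Scope complex_scope.

(* MathComp-Analysis attaches no topology to [R[i]]: take the one given
   by the modulus, as for any other numFieldType. *)
HB.instance Definition _ (R : rcfType) := NormedModule.copy R[i] R[i]^o.

Definition borelC (R : realType) := g_sigma_algebraType (@open R[i]).

Section Circle.
Context {R : realType}.

(* A function on the unit circle is represented by a function on [R[i]] of which
   only the values on [circle] are ever used. *)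
Definition circle : set R[i] := [set z | `|z| = 1].

Definition period : set R := `[0, 2 * pi].

Definition expi (x : R) : R[i] := cos x +i* sin x.

(* The modulus [`|z|] of a complex number lives in [R[i]]; this is the same
   number in [R]. *)
Definition cmod (z : R[i]) : R := Normc.normc z.

(* A complex-valued integral, taken componentwise: the library integrates only
   real and extended real functions. *)
Definition period_integral (g : R -> R[i]) : R[i] :=
  Rintegral lebesgue_measure period (fun x => complex.Re (g x)) +i*
  Rintegral lebesgue_measure period (fun x => complex.Im (g x)).

Definition fourier_coef (F : R[i] -> R[i]) (m : int) : R[i] :=
  ((2 * pi)^-1)%:C *
  period_integral (fun x => expi (- (m%:~R * x)) * F (expi x)).

Definition square_integrable (F : R[i] -> R[i]) : Prop :=
  [/\ measurable_fun period (fun x => complex.Re (F (expi x))),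
      measurable_fun period (fun x => complex.Im (F (expi x))) &
      (\int[lebesgue_measure]_(x in period)
         ((cmod (F (expi x)) ^+ 2)%R%:E) < +oo)%E].

Definition in_sobolev (s : R) (F : R[i] -> R[i]) : Prop :=
  square_integrable F /\
  (\esum_(m in [set: int])
     ((`|m|%:~R `^ (2 * s) * cmod (fourier_coef F m) ^+ 2)%:E) < +oo)%E.

(* The library sum over a set is 0 when infinitely many terms are nonzero; here,
   for k >= 1, the index set is finite. *)
Definition Delta (k : nat) (F : R[i] -> R[i]) (y : R[i]) : R[i] :=
  k%:R^-1 * \sum_(w \in [set w | circle w /\ w ^+ k = y]) F w.

End Circle.

Section Laws.
Context {R : realType}.

Definition eq_in_law d1 d2 d' (T1 : measurableType d1) (T2 : measurableType d2)
    (T' : measurableType d') (P1 : probability T1 R) (P2 : probability T2 R)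
    (X : T1 -> T') (Y : T2 -> T') : Prop :=
  forall A : set T', measurable A -> P1 (X @^-1` A) = P2 (Y @^-1` A).

Definition mutually_independent d d' (T : measurableType d)
    (T' : measurableType d') (P : probability T R)
    (X : nat -> {RV P >-> T'}) : Prop :=
  forall (J : {fset nat}) (A : nat -> set T'),
    (forall j, measurable (A j)) ->
    P (\bigcap_(j in [set` J]) X j @^-1` A j) =
    (\prod_(j <- J) P (X j @^-1` A j))%E.

Definition iid d d' (T : measurableType d) (T' : measurableType d')
    (P : probability T R) (X : nat -> {RV P >-> T'}) : Prop :=
  mutually_independent X /\ forall i j, eq_in_law P P (X i) (X j).

Definition circle_valued d (T : measurableType d) (X : T -> borelC R) : Prop :=
  forall t, circle (X t : R[i]).

End Laws.

(* Main.v *)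
Require Import Defs.
From HB Require Import structures.
From mathcomp Require Import all_boot all_order all_algebra finmap.
From mathcomp Require Import all_classical all_reals all_analysis.
From mathcomp Require Import measurable_realfun.
From mathcomp.real_closed Require Import complex.
From mathcomp Require Import ring lra.

(** Write [beta] for [(1 - theta)_+], [c_m] for the Fourier coefficients of
    [F], and [s > 1/2 + beta] for the Sobolev exponent.

    The first claim is Cauchy-Schwarz: for [beta < alpha < s - 1/2],
    [|m|^alpha |c_m|] is the product of [|m|^s |c_m|], which is square summable
    by hypothesis, and of [|m|^(alpha - s)], which is square summable because
    [2 (s - alpha) > 1] ([esum_zeta_lty]).

    For the second claim, averaging over the [k]-th roots of [y] kills the
    monomials [w^m] with [k] not dividing [m] and is bounded by [1] on the
    others, so that [|Delta_k(F, y)|] is at most the sum of [|c_m|] over the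
    nonzero multiples [m] of [k], for every [y] ([cmod_Delta_le_esum]).  This
    bound being uniform in [y], it bounds the expectation as well.  To apply the
    averages to [F] itself, [F] is approximated pointwise on the circle by its
    Fejer means ([fejer_cvg]), which are trigonometric polynomials with
    coefficients dominated by the [c_m]; only finitely many points matter for a
    given [k] and [y].

    It remains to sum over [k].  Exchanging the sums over [k] and [m], the
    series is at most the sum of [d(|m|) |m|^beta |c_m|], where [d] counts
    divisors.  By Cauchy-Schwarz again it is enough that the series of
    [d(n)^2 n^(-p)] converges for [p = 2 (s - beta) > 1]
    ([esum_divisors_sqr_lty]).  A pair of divisors [a], [c] of [n] determines,
    injectively, the factorization of [n] into [gcd(a,c)], [a / gcd(a,c)],
    [c / gcd(a,c)] and [n / lcm(a,c)], so this series is at most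
    [zeta(p)^4]. *)

Import Order.TTheory GRing.Theory Num.Theory.
Import numFieldNormedType.Exports.

Local Open Scope classical_set_scope.
Local Open Scope ring_scope.
Local Open Scope complex_scope.

Set Implicit Arguments.
Unset Strict Implicit.

(** * Sums of nonnegative families *)

Section Esum.
Context {R : realType}.
Local Open Scope ereal_scope.

Lemma esum_seq (T : choiceType) (r : seq T) (a : T -> \bar R) :
  uniq r -> (forall i, 0 <= a i) ->
  \esum_(i in [set` r]) a i = \sum_(i <- r) a i.
Proof.
by move=> ur a0; rewrite esum_fset//; exact/esym/fsbig_seq.
Qed.

Lemma esum_le_seq (T : choiceType) (I : set T) (a : T -> \bar R) (x : \bar R) :
  (forall r : seq T, uniq r -> {in r, forall i, I i} ->
     \sum_(i <- r) a i <= x) ->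
  \esum_(i in I) a i <= x.
Proof.
move=> H; apply: ge_ereal_sup => _ [X [finX XI]] <-.
rewrite fsbig_finite//; apply: H => // i.
by rewrite in_fset_set// inE => /XI.
Qed.

Lemma sum_le_esum (T : choiceType) (I : set T) (a : T -> \bar R) (r : seq T) :
  uniq r -> {in r, forall i, I i} -> \sum_(i <- r) a i <= \esum_(i in I) a i.
Proof.
move=> ur rI; apply: esum_ge; exists [set` r]; last by rewrite -fsbig_seq.
by split => // i /=; exact: rI.
Qed.

Lemma le_esum_subset (T : choiceType) (I J : set T) (a : T -> \bar R) :
  I `<=` J -> \esum_(i in I) a i <= \esum_(i in J) a i.
Proof.
by move=> IJ; apply: esum_le_seq => r ur rI; apply: sum_le_esum => // i /rI/IJ.
Qed.

(** For [c > 0] the converse inequality follows by applying this one to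
    [c^-1]. *)
Lemma le_esumZl (T : choiceType) (I : set T) (c : R) (a : T -> \bar R) :
  (0 <= c)%R -> (forall i, 0 <= a i) ->
  \esum_(i in I) (c%:E * a i) <= c%:E * \esum_(i in I) a i.
Proof.
move=> c0 a0; apply: esum_le_seq => r ur rI.
by rewrite -ge0_sume_distrr// lee_wpmul2l// sum_le_esum.
Qed.

Lemma esum_prod_lty (S T : choiceType) (f : S -> R) (g : T -> R) :
  (forall i, 0 <= f i)%R -> (forall i, 0 <= g i)%R ->
  \esum_(i in [set: S]) (f i)%:E < +oo ->
  \esum_(i in [set: T]) (g i)%:E < +oo ->
  \esum_(i in [set: S * T]) (f i.1 * g i.2)%:E < +oo.
Proof.
move=> f0 g0 fo go.
have g0' : 0 <= \esum_(i in [set: T]) (g i)%:E.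
  by apply: esum_ge0 => i _; rewrite lee_fin.
have -> : [set: S * T] = [set: S] `*`` (fun=> [set: T]).
  by apply/seteqP; split.
rewrite -(@esum_esum _ _ _ _ (fun=> setT) (fun i j => (f i * g j)%:E)); last first.
  by move=> i j _ _; rewrite lee_fin mulr_ge0.
have gE : \esum_(i in [set: T]) (g i)%:E \is a fin_num by rewrite ge0_fin_numE.
set G := fine (\esum_(i in [set: T]) (g i)%:E).
have G0 : (0 <= G)%R by rewrite fine_ge0.
apply: (@le_lt_trans _ _ (\esum_(i in [set: S]) (G%:E * (f i)%:E))).
  apply: le_esum => i _.
  under eq_esum do rewrite EFinM.
  apply: (le_trans (le_esumZl _ (f0 i) _)) => [j|]; first by rewrite lee_fin.
  by rewrite /G fineK// muleC.
apply: (le_lt_trans (le_esumZl _ G0 _)); first by move=> i; rewrite lee_fin.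
by rewrite lte_mul_pinfty.
Qed.

Lemma esum_int_absz_lty (f : nat -> \bar R) : (forall n, 0 <= f n) ->
  \esum_(n in [set: nat]) f n < +oo ->
  \esum_(m in [set: int]) f `|m|%N < +oo.
Proof.
move=> f0 fo; rewrite (esumID (range Posz))//.
rewrite !setTI esum_image; last by move=> m n _ _ [].
rewrite lte_add_pinfty//.
have : ~` range Posz `<=` range Negz.
  by move=> [n|n] //= H; [exfalso; apply: H; exists n | exists n].
move=> /(le_esum_subset (fun m : int => f `|m|%N))/le_lt_trans; apply.
rewrite esum_image; last by move=> m n _ _ [].
rewrite -(esum_image [set: nat] S) //; last by move=> m n _ _ [].
exact: le_lt_trans (le_esum_subset _ _) fo.
Qed.

End Esum.

(** * The zeta series and the mean square of the divisor function *)

Section Zeta.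
Context {R : realType}.
Variables (p : R) (p1 : 1 < p).

Let u (n : nat) : R := n%:R `^ (- p).

(** The terms of index [2i] and [2i+1] are both at most [2^(-p) u i]; for
    [i = 0] the second one is [1], whence the last summand.  As
    [2^(1-p) < 1], this self-similarity bounds all partial sums. *)
Let u_double (N : nat) :
  \sum_(0 <= i < N.*2) u i <= 2 `^ (1 - p) * \sum_(0 <= i < N) u i + (0 < N)%:R.
Proof.
have p0 : p != 0 by rewrite gt_eqF// (lt_trans _ p1).
elim: N => [|N IH]; first by rewrite !big_geq// mulr0 addr0.
rewrite doubleS !big_nat_recr//= mulrDr.
have uD : u N.*2 = 2 `^ (- p) * u N by rewrite /u -powRM// -natrM mul2n.
have e2 : 2 `^ (1 - p) = 2 * 2 `^ (- p) :> R.
  by rewrite powRD ?powRr1// pnatr_eq0 implybT.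
have uS : u N.*2.+1 <= 2 `^ (- p) * u N + (N == 0)%N%:R.
  case: N {IH uD} => [|N]; first by rewrite /u double0 powR1 powR0 ?oppr_eq0// mulr0 add0r.
  rewrite addr0 /u -powRM// -natrM mul2n !powRN lef_pV2 ?posrE ?powR_gt0//.
  rewrite ge0_ler_powR ?nnegrE ?ler0n ?ler_nat//.
  by rewrite ltW// (lt_trans _ p1).
have : (0 < N)%:R + (N == 0)%N%:R = 1 :> R by case: (N) => [|n]; rewrite ?addr0 ?add0r.
move: IH uS; rewrite e2 uD; lra.
Qed.

(** The term at [n = 0] is [0], by the convention [0 `^ x = 0] for [x != 0]. *)
Lemma esum_zeta_lty : (\esum_(n in [set: nat]) (n%:R `^ (- p))%:E < +oo :> \bar R)%E.
Proof.
have p0 : 0 < p by rewrite (lt_trans _ p1).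
have q1 : 2 `^ (1 - p) < 1 :> R.
  rewrite -[ltRHS](powRr0 2).
  by rewrite /powR pnatr_eq0/= ltr_expR mul0r nmulr_rlt0 ?ln_gt0 ?ltr1n ?subr_lt0.
pose C : R := (1 - 2 `^ (1 - p))^-1.
have SC N : \sum_(0 <= i < N) u i <= C.
  rewrite /C -[leRHS]mul1r ler_pdivlMr ?subr_gt0//.
  have : \sum_(0 <= i < N) u i <= \sum_(0 <= i < N.*2) u i.
    rewrite (@big_cat_nat _ _ _ N 0%N N.*2)//=; last by rewrite -addnn leq_addr.
    by rewrite lerDl sumr_ge0// => i _; rewrite powR_ge0.
  move=> /le_trans/(_ (u_double N)).
  have : (0 < N)%:R <= 1 :> R by rewrite lern1 leq_b1.
  by set b := (_ < _)%:R; set S := \sum_(_ <= _ < _) _ => *; lra.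
rewrite -nneseries_esumT => [|n]; last by rewrite lee_fin powR_ge0.
apply: (@le_lt_trans _ _ C%:E); last exact: ltry.
apply: lime_le; first by apply: is_cvg_nneseries => n _ _; rewrite lee_fin powR_ge0.
by apply: nearW => n; rewrite sumEFin lee_fin SC.
Qed.

End Zeta.

Section Divisors.
Context {R : realType}.

(** The square of the number of divisors of [n] counts the pairs [(a, c)] of
    divisors, and [(n, a, c)] can be recovered from the four factors
    [gcd(a,c)], [a / gcd(a,c)], [c / gcd(a,c)], [n / lcm(a,c)], whose product
    is [n].  So the series is part of the fourth power of the zeta series. *)
Lemma esum_divisors_sqr_lty (p : R) : 1 < p ->
  (\esum_(n in [set: nat])
     (n%:R `^ (- p) * (size (divisors n))%:R ^+ 2)%:E < +oo :> \bar R)%E.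
Proof.
move=> p1; have p0 : - p != 0 by rewrite oppr_eq0 gt_eqF// (lt_trans _ p1).
pose u (n : nat) : R := n%:R `^ (- p).
have u0 n : 0 <= u n by exact: powR_ge0.
pose pairs n : set (nat * nat) := [set` [seq (a, c) | a <- divisors n, c <- divisors n]].
have -> : (\esum_(n in [set: nat])
     (n%:R `^ (- p) * (size (divisors n))%:R ^+ 2)%:E =
   \esum_(n in [set n | (0 < n)%N]) \esum_(ac in pairs n) (u n)%:E)%E.
  rewrite [LHS]esum_mkcond [RHS]esum_mkcond; apply: eq_esum => n _.
  rewrite mem_set//.
  case: ifPn => [_|]; last first.
    by rewrite notin_setE/= => /negP; rewrite lt0n negbK => /eqP ->; rewrite powR0 ?mul0r.
  rewrite esum_seq ?lee_fin//; last first.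
    by apply: allpairs_uniq; [exact: divisors_uniq|exact: divisors_uniq|move=> [? ?] [? ?]].
  rewrite sumEFin big_const_seq count_predT size_allpairs iter_addr_0.
  by rewrite -[in RHS]mulr_natr natrM expr2.
rewrite esum_esum; last by move=> *; rewrite lee_fin.
pose D : set (nat * (nat * nat)) := [set n | (0 < n)%N] `*`` pairs.
(* the injection of triples into factorizations in four factors *)
pose phi (t : nat * (nat * nat)) : (nat * nat) * (nat * nat) :=
  let: (n, (a, c)) := t in let x := gcdn a c in
  ((x, a %/ x), (c %/ x, n %/ lcmn a c))%N.
have phiK n a c : D (n, (a, c)) -> let: ((x, y), (z, w)) := phi (n, (a, c)) in
   [/\ a = (x * y)%N, c = (x * z)%N & n = (x * y * (z * w))%N].
  case=> /= n0 /allpairsP[[i j] /= [+ + [ai cj]]]; rewrite -{}ai -{}cj => {i j}.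
  rewrite -?dvdn_divisors// => an cn.
  have aE : a = (gcdn a c * (a %/ gcdn a c))%N by rewrite mulnC divnK ?dvdn_gcdl.
  have cE : c = (gcdn a c * (c %/ gcdn a c))%N by rewrite mulnC divnK ?dvdn_gcdr.
  split=> //.
  by rewrite mulnA -aE [(a * _)%N]muln_divA ?dvdn_gcdr// -/(lcmn a c) mulnC divnK// dvdn_lcm an.
have injphi : set_inj D phi.
  move=> [n [a c]] [n' [a' c']]; rewrite !inE => /phiK h /phiK h' e.
  move: h h'; rewrite e; case: (phi _) => [[x y] [z w]].
  by move=> [-> -> ->] [-> -> ->].
have uM m n : u (m * n)%N = u m * u n by rewrite /u natrM powRM.
pose v (t : nat * nat) : R := u t.1 * u t.2.
have v0 t : 0 <= v t by rewrite mulr_ge0.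
have vo : (\esum_(t in [set: nat * nat]) (v t)%:E < +oo)%E.
  by apply: esum_prod_lty => //; exact: esum_zeta_lty.
have -> : (\esum_(k in D) (u k.1)%:E = \esum_(t in phi @` D) (v t.1 * v t.2)%:E)%E.
  rewrite esum_image//; apply: eq_esum => -[n [a c]] /phiK.
  by rewrite /v; case: (phi _) => [[x y] [z w]] /= [_ _ ->]; rewrite !uM.
exact: (le_lt_trans (le_esum_subset _ _) (esum_prod_lty _ _ vo vo)).
Qed.

End Divisors.

(** * The modulus and the exponential parametrization of the circle *)

Section Modulus.
Context {R : realType}.
Implicit Types (z w : R[i]) (x y : R).

Lemma normC_cmod z : `|z| = (cmod z)%:C.
Proof. by []. Qed.

Lemma cmod_ge0 z : 0 <= cmod z.
Proof. by case: z => a b; exact: sqrtr_ge0. Qed.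

Lemma cmodM z w : cmod (z * w) = cmod z * cmod w.
Proof. by apply: complexI; rewrite -normC_cmod normrM rmorphM. Qed.

Lemma cmodX z n : cmod (z ^+ n) = cmod z ^+ n.
Proof. by apply: complexI; rewrite -normC_cmod normrX rmorphXn. Qed.

Lemma cmodB z w : cmod (z - w) = cmod (w - z).
Proof. by apply: complexI; rewrite -!normC_cmod distrC. Qed.

Lemma cmodJ z : cmod (z^*) = cmod z.
Proof. by apply: complexI; rewrite -normC_cmod normcJ. Qed.

Lemma cmod_real x : cmod x%:C = `|x|.
Proof. by rewrite /cmod /= expr0n/= addr0 sqrtr_sqr. Qed.

Lemma cmodD z w : cmod (z + w) <= cmod z + cmod w.
Proof. by rewrite -lecR rmorphD/= -!normC_cmod ler_normD. Qed.

Lemma cmod_sum (I : Type) (r : seq I) (P : pred I) (f : I -> R[i]) :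
  cmod (\sum_(i <- r | P i) f i) <= \sum_(i <- r | P i) cmod (f i).
Proof. by rewrite -lecR rmorph_sum/= -normC_cmod ler_norm_sum. Qed.

Lemma cmod_le_ReIm z : cmod z <= `|complex.Re z| + `|complex.Im z|.
Proof.
rewrite {1}[z]complexE (le_trans (cmodD _ _))// cmodM !cmod_real.
by rewrite (_ : cmod 'i%C = 1) ?mul1r// /cmod/= expr0n/= expr1n add0r sqrtr1.
Qed.

Lemma Re_le_cmod z : `|complex.Re z| <= cmod z.
Proof. by rewrite -lecR -normC_cmod normc_ge_Re. Qed.

Lemma Im_le_cmod z : `|complex.Im z| <= cmod z.
Proof.
have := Re_le_cmod (z * 'i%C); rewrite ReiNIm normrN => /le_trans; apply.
by rewrite cmodM (_ : cmod 'i%C = 1) ?mulr1// /cmod/= expr0n/= expr1n add0r sqrtr1.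
Qed.

Lemma mulJ_cmod z : z * z^* = (cmod z ^+ 2)%:C.
Proof. by rewrite -sqr_normc normC_cmod rmorphXn. Qed.

Lemma circleP z : circle z <-> cmod z = 1.
Proof.
by rewrite /circle/= normC_cmod; split => [/complexI//|->].
Qed.

End Modulus.

Section Expi.
Context {R : realType}.
Implicit Types x y : R.

Lemma expi0 : expi 0 = 1 :> R[i].
Proof. by rewrite /expi cos0 sin0. Qed.

Lemma expiD x y : expi (x + y) = expi x * expi y.
Proof.
by rewrite /expi cosD sinD; simpc; congr (_ +i* _); rewrite addrC.
Qed.

Lemma expi_natmul n x : expi (n%:R * x) = expi x ^+ n.
Proof.
elim: n => [|n IH]; first by rewrite mul0r expi0.
by rewrite -natr1 mulrDl mul1r expiD IH exprSr.
Qed.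

Lemma cmod_expi x : cmod (expi x) = 1.
Proof. by rewrite /cmod/= cos2Dsin2 sqrtr1. Qed.

Lemma circle_expi x : circle (expi x).
Proof. exact/circleP/cmod_expi. Qed.

End Expi.

(** * Means of continuous functions over a period *)

Section Ccontinuous.
Context {R : realType}.
Implicit Types g h : R -> R[i].

(** Integrals are taken componentwise, so continuity is wanted in this form. *)
Definition ccontinuous g :=
  continuous (fun x => complex.Re (g x)) /\ continuous (fun x => complex.Im (g x)).

Lemma ccontinuous_cst c : ccontinuous (fun=> c).
Proof. by split => x; exact: cvg_cst. Qed.

Lemma ccontinuousD g h : ccontinuous g -> ccontinuous h ->
  ccontinuous (fun x => g x + h x).
Proof.
move=> [g1 g2] [h1 h2]; split => x.
  rewrite (_ : (fun _ => _) = (fun x => complex.Re (g x) + complex.Re (h x))).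
    by apply: cvgD; [exact: g1|exact: h1].
  by apply/funext => y; case: (g y); case: (h y).
rewrite (_ : (fun _ => _) = (fun x => complex.Im (g x) + complex.Im (h x))).
  by apply: cvgD; [exact: g2|exact: h2].
by apply/funext => y; case: (g y); case: (h y).
Qed.

Lemma ccontinuousM g h : ccontinuous g -> ccontinuous h ->
  ccontinuous (fun x => g x * h x).
Proof.
move=> [g1 g2] [h1 h2]; split => x.
  rewrite (_ : (fun _ => _) = (fun x => complex.Re (g x) * complex.Re (h x) -
     complex.Im (g x) * complex.Im (h x))).
    by apply: cvgB; apply: cvgM; [exact: g1|exact: h1|exact: g2|exact: h2].
  by apply/funext => y; case: (g y); case: (h y).
rewrite (_ : (fun _ => _) = (fun x => complex.Re (g x) * complex.Im (h x) +
     complex.Im (g x) * complex.Re (h x))).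
  by apply: cvgD; apply: cvgM; [exact: g1|exact: h2|exact: g2|exact: h1].
by apply/funext => y; case: (g y); case: (h y).
Qed.

Lemma ccontinuous_sum (I : Type) (r : seq I) (f : I -> R -> R[i]) :
  (forall i, ccontinuous (f i)) -> ccontinuous (fun x => \sum_(i <- r) f i x).
Proof.
move=> fc; elim: r => [|i r IH].
  by under eq_fun do rewrite big_nil; exact: ccontinuous_cst.
by under eq_fun do rewrite big_cons; exact: ccontinuousD.
Qed.

Lemma ccontinuous_expi a : ccontinuous (fun x => expi (- (a * x))).
Proof.
have c : continuous (fun x : R => - (a * x)).
  by move=> x; apply: cvgN; apply: cvgM; [exact: cvg_cst|exact: cvg_id].
split => x /=.
  by apply: (@continuous_comp _ _ _ (fun x : R => - (a * x)) cos); [exact: c|exact: continuous_cos].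
by apply: (@continuous_comp _ _ _ (fun x : R => - (a * x)) sin); [exact: c|exact: continuous_sin].
Qed.

(** Continuity on the circle, with real instead of complex radii. *)
Lemma within_circle_dist (F : R[i] -> R[i]) (w : R[i]) (e : R) :
  {within circle, continuous F} -> circle w -> 0 < e ->
  exists2 d : R, 0 < d & forall v, circle v -> cmod (v - w) < d ->
    cmod (F v - F w) < e.
Proof.
move=> /subspace_continuousP cF cw e0.
have ec : 0 < e%:C :> R[i] by rewrite (ltcR 0 e).
have /cvgrPdist_lt/(_ _ ec) := cF _ cw.
rewrite near_withinE => /nbhs_ballP[d /= d0 H].
have dE : d = (complex.Re d)%:C by rewrite RRe_real// ger0_real// ltW.
exists (complex.Re d); first by rewrite -ltcR -dE.
move=> v cv vw; rewrite -ltcR cmodB -normC_cmod; apply: H => //.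
by rewrite -ball_normE/= dE normC_cmod ltcR cmodB.
Qed.

Lemma ccontinuous_expi_comp (F : R[i] -> R[i]) :
  {within circle, continuous F} -> ccontinuous (fun x => F (expi x)).
Proof.
move=> cF.
have H (x e : R) : 0 < e -> \forall y \near x, cmod (F (expi y) - F (expi x)) < e.
  move=> e0; have [d d0 Hd] := within_circle_dist cF (circle_expi x) e0.
  have d20 : 0 < d / 2 by rewrite divr_gt0.
  have /cvgrPdist_lt/(_ _ d20) c := @continuous_cos R x.
  have /cvgrPdist_lt/(_ _ d20) s := @continuous_sin R x.
  near=> y; apply: Hd; first exact: circle_expi.
  rewrite (le_lt_trans (cmod_le_ReIm _))//= [ltRHS](splitr d).
  by rewrite ltrD// distrC; near: y.
split => x; apply/cvgrPdist_lt => e e0; near=> y.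
  rewrite distrC (_ : _ - _ = complex.Re (F (expi y) - F (expi x))).
    by rewrite (le_lt_trans (Re_le_cmod _))//; near: y; exact: H.
  by case: (F _); case: (F _).
rewrite distrC (_ : _ - _ = complex.Im (F (expi y) - F (expi x))).
  by rewrite (le_lt_trans (Im_le_cmod _))//; near: y; exact: H.
by case: (F _); case: (F _).
Unshelve. all: by end_near. Qed.

End Ccontinuous.

Section Mean.
Context {R : realType}.
Implicit Types g h : R -> R[i].
Notation mu := (@lebesgue_measure R).

Lemma measurable_period : measurable (@period R : set (measurableTypeR R)).
Proof. exact: measurable_itv. Qed.

Lemma continuous_integrable_period (f : R -> R) : continuous f ->
  mu.-integrable period (EFin \o f).
Proof.
move=> cf; apply: continuous_compact_integrable; first exact: segment_compact.
exact: continuous_subspaceT.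
Qed.

Lemma period_integralD g h : ccontinuous g -> ccontinuous h ->
  period_integral (fun x => g x + h x) = period_integral g + period_integral h.
Proof.
move=> [g1 g2] [h1 h2]; rewrite /period_integral; simpc.
have mp := measurable_period; have ci := continuous_integrable_period.
rewrite -(RintegralD mp (ci _ g1) (ci _ h1)) -(RintegralD mp (ci _ g2) (ci _ h2)).
by congr (_ +i* _); apply: eq_Rintegral => x _; case: (g x); case: (h x).
Qed.

Lemma period_integralZ c g : ccontinuous g ->
  period_integral (fun x => c * g x) = c * period_integral g.
Proof.
case: c => a b [g1 g2]; rewrite /period_integral; simpc.
have mp := measurable_period.
have i1 := continuous_integrable_period g1.
have i2 := continuous_integrable_period g2.
have z k (f : R -> R) : continuous f -> mu.-integrable period (EFin \o (fun x => k * f x)).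
  by move=> cf; apply: continuous_integrable_period => x; apply: cvgM; [exact: cvg_cst|exact: cf].
rewrite -!(RintegralZl _ mp)//.
rewrite -(RintegralB mp (z a _ g1) (z b _ g2)) -(RintegralD mp (z a _ g2) (z b _ g1)).
by congr (_ +i* _); apply: eq_Rintegral => x _; case: (g x).
Qed.

Lemma period_integral_sum (I : Type) (r : seq I) (f : I -> R -> R[i]) :
  (forall i, ccontinuous (f i)) ->
  period_integral (fun x => \sum_(i <- r) f i x) = \sum_(i <- r) period_integral (f i).
Proof.
move=> fc; elim: r => [|i r IH].
  rewrite big_nil -[RHS](mul0r (period_integral (fun=> 0))) -period_integralZ.
    by congr period_integral; apply/funext => x; rewrite big_nil mulr0.
  exact: ccontinuous_cst.
rewrite big_cons -IH -period_integralD//; last exact: ccontinuous_sum.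
by congr period_integral; apply/funext => x; rewrite big_cons.
Qed.

Definition mean g : R[i] := ((2 * pi)^-1)%:C * period_integral g.

Lemma meanD g h : ccontinuous g -> ccontinuous h ->
  mean (fun x => g x + h x) = mean g + mean h.
Proof. by move=> cg ch; rewrite /mean period_integralD// mulrDr. Qed.

Lemma meanZ c g : ccontinuous g -> mean (fun x => c * g x) = c * mean g.
Proof. by move=> cg; rewrite /mean period_integralZ// mulrCA. Qed.

Lemma mean_sum (I : Type) (r : seq I) (f : I -> R -> R[i]) :
  (forall i, ccontinuous (f i)) ->
  mean (fun x => \sum_(i <- r) f i x) = \sum_(i <- r) mean (f i).
Proof. by move=> fc; rewrite /mean period_integral_sum// mulr_sumr. Qed.

Lemma pi2_gt0 : 0 < 2 * pi :> R.
Proof. by rewrite mulr_gt0// pi_gt0. Qed.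

Lemma Rintegral_period_cst (c : R) : \int[mu]_(x in period) c = c * (2 * pi).
Proof.
have muE : mu period = (2 * pi)%:E.
  rewrite [LHS](@lebesgue_measure_itv _ `[0, 2 * pi]%R) /= lte_fin pi2_gt0.
  by rewrite oppr0 adde0.
by rewrite (Rintegral_cst _ measurable_period) [X in fine X]muE.
Qed.

Lemma cos_intmul_2pi (m : int) : cos (m%:~R * (2 * pi)) = 1 :> R.
Proof.
have h n : cos (n%:R * (2 * pi)) = 1 :> R.
  rewrite [2 * pi]mulrC mulr_natr mulr_natl -[_ *+ n]add0r.
  by rewrite (periodicn (@cosD2pi R)) cos0.
by case: m => n; rewrite ?NegzE ?mulrNz ?mulNr ?cosN; exact: h.
Qed.

Lemma sin_intmul_2pi (m : int) : sin (m%:~R * (2 * pi)) = 0 :> R.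
Proof.
have h n : sin (n%:R * (2 * pi)) = 0 :> R.
  rewrite [2 * pi]mulrC mulr_natr mulr_natl -[_ *+ n]add0r.
  by rewrite (periodicn (@sinD2pi R)) sin0.
by case: m => n; rewrite ?NegzE ?mulrNz ?mulNr ?sinN ?h ?oppr0.
Qed.

Lemma Rintegral_period_derive (F f : R -> R) :
  (forall x, is_derive x (1 : R) F (f x)) -> continuous f ->
  \int[mu]_(x in period) f x = F (2 * pi) - F 0.
Proof.
move=> dF cf.
have cF : continuous F.
  move=> x; have [dFx _] := dF x.
  exact/differentiable_continuous/derivable1_diffP.
rewrite /Rintegral (@continuous_FTC2 _ f F 0 (2 * pi)).
- by rewrite -EFinB.
- exact: pi2_gt0.
- exact: continuous_subspaceT.
- split; first by move=> x _; case: (dF x).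
  + exact/cvg_at_right_filter/cF.
  + exact/cvg_at_left_filter/cF.
- by move=> x _; rewrite derive1E; case: (dF x).
Qed.

Lemma mean_expi (m : int) :
  mean (fun x => expi (- (m%:~R * x))) = (m == 0)%:R.
Proof.
have [->|m0] := eqVneq m 0.
  rewrite /mean /period_integral (_ : Rintegral _ _ _ = 2 * pi); last first.
    rewrite -[RHS]mul1r -Rintegral_period_cst; apply: eq_Rintegral => x _.
    by rewrite mul0r oppr0 /= cos0.
  rewrite (_ : Rintegral _ _ _ = 0); last first.
    rewrite -[RHS](mul0r (2 * pi)) -Rintegral_period_cst; apply: eq_Rintegral => x _.
    by rewrite mul0r oppr0 /= sin0.
  by rewrite complexr0 -rmorphM/= mulVf// gt_eqF// pi2_gt0.
have m0' : m%:~R != 0 :> R by rewrite intr_eq0.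
have cm : continuous (fun x : R => m%:~R * x : R).
  by move=> x; apply: cvgM; [exact: cvg_cst|exact: cvg_id].
rewrite /mean /period_integral.
rewrite (_ : Rintegral _ _ _ = 0); last first.
  apply: (etrans (@Rintegral_period_derive (fun x => (m%:~R)^-1 * sin (m%:~R * x)) _ _ _)).
  - move=> x; rewrite /= cosN; apply: is_derive_eq.
    by rewrite /GRing.scale/= mulr1 mulrC mulfK.
  - under eq_fun do rewrite /= cosN.
    by move=> x; apply: (@continuous_comp _ _ _ (fun x : R => m%:~R * x) cos); [exact: cm|exact: continuous_cos].
  - by rewrite /= sin_intmul_2pi !mulr0 sin0 mulr0 subrr.
rewrite (_ : Rintegral _ _ _ = 0); last first.
  apply: (etrans (@Rintegral_period_derive (fun x => (m%:~R)^-1 * cos (m%:~R * x)) _ _ _)).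
  - move=> x; rewrite /= sinN; apply: is_derive_eq.
    by rewrite /GRing.scale/= mulr1 mulrC mulfK.
  - under eq_fun do rewrite /= sinN.
    by move=> x; apply: cvgN; apply: (@continuous_comp _ _ _ (fun x : R => m%:~R * x) sin); [exact: cm|exact: continuous_sin].
  - by rewrite /= cos_intmul_2pi !mulr0 cos0 subrr.
by rewrite complexr0 mulr0.
Qed.

End Mean.

(** * The theorem of Fejer *)

Section Fejer.
Context {R : realType}.
Implicit Types (g : R -> R[i]) (F : R[i] -> R[i]) (w : R[i]) (N : nat).
Notation mu := (@lebesgue_measure R).

(** The Fejer kernel at [w / e^(ix)], as a normalized square of a geometric sum;
    this form shows that it is nonnegative and, by summing the geometric
    progression, that it is small away from [e^(ix) = w]. *)
Definition fejer_kernel N w (x : R) : R :=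
  N%:R^-1 * cmod (\sum_(j < N) (w * expi (- x)) ^+ j) ^+ 2.

(** For [|w| = 1] the double sum over [j] and [l] is the usual sum over
    [m = j - l] of [(1 - |m| / N) c_m w^m]; it avoids negative powers and
    counting the pairs with a given difference. *)
Definition fejer_mean N F w : R[i] :=
  N%:R^-1 * \sum_(j < N) \sum_(l < N)
    (w ^+ j * (w^*) ^+ l) * fourier_coef F (j%:Z - l%:Z).

Lemma fejer_kernelE N w x : (fejer_kernel N w x)%:C =
  N%:R^-1 * \sum_(j < N) \sum_(l < N)
    (w ^+ j * (w^*) ^+ l) * expi (- ((j%:Z - l%:Z)%:~R * x)).
Proof.
rewrite /fejer_kernel rmorphM/= fmorphV rmorph_nat -mulJ_cmod rmorph_sum/=.
congr (_ * _); rewrite big_distrlr/=; apply: eq_bigr => j _; apply: eq_bigr => l _.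
rewrite rmorphXn rmorphM/= !exprMn.
rewrite [X in _ * (_ * X ^+ _)](_ : _ = expi x); last first.
  by apply/eqP; rewrite eq_complex /= cosN sinN opprK !eqxx.
rewrite -!expi_natmul mulrACA -expiD.
congr (_ * expi _); rewrite rmorphB/= -!pmulrn; ring.
Qed.

Lemma fejer_kernel_ge0 N w x : 0 <= fejer_kernel N w x.
Proof. by rewrite mulr_ge0// ?invr_ge0// sqr_ge0. Qed.

Lemma ccontinuous_kernel N w : ccontinuous (fun x => (fejer_kernel N w x)%:C).
Proof.
under eq_fun do rewrite fejer_kernelE.
apply: ccontinuousM; first exact: ccontinuous_cst.
apply: ccontinuous_sum => j; apply: ccontinuous_sum => l.
by apply: ccontinuousM; [exact: ccontinuous_cst|exact: ccontinuous_expi].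
Qed.

Lemma mean_kernel N w g : ccontinuous g ->
  mean (fun x => (fejer_kernel N w x)%:C * g x) =
  N%:R^-1 * \sum_(j < N) \sum_(l < N) (w ^+ j * (w^*) ^+ l) *
    mean (fun x => expi (- ((j%:Z - l%:Z)%:~R * x)) * g x).
Proof.
move=> cg.
have ce m : ccontinuous (fun x => expi (- (m%:~R * x)) * g x).
  by apply: ccontinuousM => //; exact: ccontinuous_expi.
have ces (j l : nat) : ccontinuous (fun x => (w ^+ j * (w^*) ^+ l) *
    (expi (- ((j%:Z - l%:Z)%:~R * x)) * g x)).
  by apply: ccontinuousM => //; exact: ccontinuous_cst.
transitivity (mean (fun x => N%:R^-1 * \sum_(j < N) \sum_(l < N)
    (w ^+ j * (w^*) ^+ l) * (expi (- ((j%:Z - l%:Z)%:~R * x)) * g x))).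
  congr mean; apply/funext => x; rewrite fejer_kernelE -mulrA; congr (_ * _).
  rewrite mulr_suml; apply: eq_bigr => j _; rewrite mulr_suml.
  by apply: eq_bigr => l _; rewrite mulrA.
rewrite meanZ; last by do 2 (apply: ccontinuous_sum => ?); exact: ces.
congr (_ * _); rewrite mean_sum => [|j]; last by apply: ccontinuous_sum => l; exact: ces.
apply: eq_bigr => j _; rewrite mean_sum => [|l]; last exact: ces.
by apply: eq_bigr => l _; rewrite meanZ.
Qed.

Lemma fejer_meanE N F w : {within circle, continuous F} ->
  fejer_mean N F w = mean (fun x => (fejer_kernel N w x)%:C * F (expi x)).
Proof. by move=> cF; rewrite mean_kernel//; exact: ccontinuous_expi_comp. Qed.

(** Only the diagonal terms [j = l] have a nonzero mean, and there are [N] of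
    them. *)
Lemma mean_kernel_cst N w c : circle w -> (0 < N)%N ->
  mean (fun x => (fejer_kernel N w x)%:C * c) = c.
Proof.
move=> /circleP w1 N0; rewrite mean_kernel; last exact: ccontinuous_cst.
have ww : w * w^* = 1 by rewrite mulJ_cmod w1 expr1n.
transitivity (N%:R^-1 * \sum_(j < N) c); last first.
  by rewrite sumr_const card_ord -[c *+ N]mulr_natl mulrA mulVf ?mul1r// pnatr_eq0 -lt0n.
congr (_ * _); apply: eq_bigr => j _; rewrite (bigD1 j)//= big1 => [|l lj].
  under eq_fun do rewrite mulrC.
  rewrite meanZ; last exact: ccontinuous_expi.
  by rewrite mean_expi subrr eqxx mulr1 addr0 -exprMn ww expr1n mul1r.
under eq_fun do rewrite mulrC.
rewrite meanZ; last exact: ccontinuous_expi.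
by rewrite mean_expi subr_eq0 eqz_nat eq_sym (inj_eq val_inj) (negPf lj) !mulr0.
Qed.

Lemma Re_realM (a : R) (z : R[i]) : complex.Re (a%:C * z) = a * complex.Re z.
Proof. by case: z => x y /=; ring. Qed.

Lemma Im_realM (a : R) (z : R[i]) : complex.Im (a%:C * z) = a * complex.Im z.
Proof. by case: z => x y /=; ring. Qed.

Lemma mean_real_fun (f : R -> R) :
  mean (fun x => (f x)%:C) = ((2 * pi)^-1 * \int[mu]_(x in period) f x)%:C.
Proof.
rewrite /mean /period_integral /=.
by rewrite Rintegral_period_cst mul0r complexr0 -rmorphM.
Qed.

Lemma Rintegral_kernel N w : circle w -> (0 < N)%N ->
  \int[mu]_(x in period) fejer_kernel N w x = 2 * pi.
Proof.
move=> cw N0; have := mean_kernel_cst 1 cw N0.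
under eq_fun do rewrite mulr1.
rewrite mean_real_fun => /complexI /(congr1 ( *%R (2 * pi))).
by rewrite mulrA divff ?gt_eqF ?pi2_gt0// mul1r mulr1.
Qed.

(** For [u = w / e^(ix)], [(u - 1) (1 + u + ... + u^(N-1)) = u^N - 1] has
    modulus at most [2], and [|u - 1| = |e^(ix) - w|]. *)
Lemma fejer_kernel_le N w x (d : R) : circle w -> 0 < d ->
  d <= cmod (expi x - w) -> fejer_kernel N w x <= 4 / d ^+ 2 / N%:R.
Proof.
move=> /circleP w1 d0 dx; rewrite /fejer_kernel mulrC ler_wpM2r ?invr_ge0//.
set u := w * expi (- x); set q := \sum_(j < N) _.
have u1 : cmod u = 1 by rewrite cmodM w1 cmod_expi mulr1.
have uq : cmod (u - 1) * cmod q <= 2.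
  rewrite -cmodM -subrX1 (le_trans (cmodD _ _))// cmodX u1 expr1n.
  by rewrite (_ : cmod (-1) = 1)//; apply: complexI; rewrite -normC_cmod normrN1.
have du : cmod (u - 1) = cmod (expi x - w).
  rewrite cmodB -[RHS]mulr1 -(cmod_expi (- x)) -cmodM mulrBl -expiD subrr expi0.
  by [].
rewrite ler_pdivlMr ?exprn_gt0// -exprMn (_ : 4 = 2 ^+ 2); last by rewrite -natrX.
rewrite lerXn2r ?nnegrE ?mulr_ge0 ?cmod_ge0 ?(ltW d0)//.
by rewrite (le_trans _ uq)// mulrC ler_wpM2r ?cmod_ge0// du.
Qed.

(** The concentration argument: where [f] is not small the kernel is, and the
    kernel has total mass [2 pi]. *)
Lemma Rintegral_kernel_le N w (f : R -> R) (e M : R) :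
  circle w -> (0 < N)%N -> continuous f ->
  (forall x, `|f x| < e \/ fejer_kernel N w x <= M) -> 0 <= e -> 0 <= M ->
  `| \int[mu]_(x in period) (fejer_kernel N w x * f x) | <=
    e * (2 * pi) + M * \int[mu]_(x in period) `|f x|.
Proof.
move=> cw N0 cf H e0 M0.
have [ck _] := ccontinuous_kernel N w; rewrite /= in ck.
have mp := @measurable_period R; have ci := @continuous_integrable_period R.
have ckf : continuous (fun x => fejer_kernel N w x * f x).
  by move=> x; apply: cvgM; [exact: ck|exact: cf].
have cnf : continuous (fun x => `|f x|).
  by move=> x; apply: cvg_norm; exact: cf.
have cZ (k : R) (h : R -> R) : continuous h -> continuous (fun x => k * h x).
  by move=> ch x; apply: cvgM; [exact: cvg_cst|exact: ch].
rewrite (le_trans (le_normr_Rintegral mp (ci _ ckf)))//.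
rewrite -(Rintegral_kernel cw N0) -(RintegralZl _ mp (ci _ ck)).
rewrite -(RintegralZl _ mp (ci _ cnf)).
rewrite -(RintegralD mp (ci _ (cZ _ _ ck)) (ci _ (cZ _ _ cnf))).
apply: (le_Rintegral mp) => [||x _].
- by apply: ci => x; apply: cvg_norm; exact: ckf.
- by apply: ci => x; apply: cvgD; [exact: (cZ e _ ck x)|exact: (cZ M _ cnf x)].
- rewrite normrM (ger0_norm (fejer_kernel_ge0 _ _ _)).
  have k0 := fejer_kernel_ge0 N w x; have f0 := normr_ge0 (f x).
  have [fe|kM] := H x.
    by rewrite ler_wpDr ?mulr_ge0// mulrC ler_wpM2r// ltW.
  by apply: ler_wpDl; [exact: mulr_ge0|exact: ler_wpM2r].
Qed.

(** [F(e^(ix)) - F(w)] is small for [e^(ix)] near [w], and elsewhere the kernel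
    is [O(1/N)]; both components are treated by [Rintegral_kernel_le]. *)
Lemma fejer_cvg F w (e : R) : {within circle, continuous F} -> circle w ->
  0 < e -> \forall N \near \oo, cmod (fejer_mean N F w - F w) < e.
Proof.
move=> cF cw e0.
pose e4 := e / 4; have e40 : 0 < e4 by rewrite divr_gt0.
have [d d0 Hd] := within_circle_dist cF cw e40.
have [c1 c2] := ccontinuousD (ccontinuous_expi_comp cF) (ccontinuous_cst (- F w)).
set g := fun x => F (expi x) - F w in c1 c2.
pose I1 := \int[mu]_(x in period) `|complex.Re (g x)|.
pose I2 := \int[mu]_(x in period) `|complex.Im (g x)|.
(* [C / N] bounds the contribution of the points at distance at least [d]. *)
pose C := (2 * pi)^-1 * (4 / d ^+ 2) * (I1 + I2).
near=> N.
have N0 : (0 < N)%N by near: N; exact: nbhs_infty_gt.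
have CN : C / N%:R < e / 2.
  rewrite ltr_pdivrMr ?ltr0n// mulrC -ltr_pdivrMr ?divr_gt0//.
  by near: N; exact: nbhs_infty_gtr.
pose M := 4 / d ^+ 2 / N%:R.
have M0 : 0 <= M by rewrite !divr_ge0// exprn_ge0// ltW.
have dich x : cmod (g x) < e4 \/ fejer_kernel N w x <= M.
  have [xd|dx] := ltP (cmod (expi x - w)) d.
    by left; apply: Hd => //; exact: circle_expi.
  by right; exact: fejer_kernel_le.
have b1 := @Rintegral_kernel_le N w _ e4 M cw N0 c1 _ (ltW e40) M0.
have b2 := @Rintegral_kernel_le N w _ e4 M cw N0 c2 _ (ltW e40) M0.
have E : fejer_mean N F w - F w = mean (fun x => (fejer_kernel N w x)%:C * g x).
  rewrite fejer_meanE// -[in LHS](mean_kernel_cst (F w) cw N0).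
  rewrite -[X in _ + X]mulN1r -meanZ; last first.
    apply: ccontinuousM; [exact: ccontinuous_kernel|exact: ccontinuous_cst].
  rewrite -meanD.
  - by congr mean; apply/funext => x; rewrite /g mulrBr mulN1r.
  - apply: ccontinuousM; [exact: ccontinuous_kernel|exact: ccontinuous_expi_comp].
  - apply: ccontinuousM; first exact: ccontinuous_cst.
    apply: ccontinuousM; [exact: ccontinuous_kernel|exact: ccontinuous_cst].
have p0 := @pi2_gt0 R.
rewrite E /mean cmodM cmod_real gtr0_norm ?invr_gt0//.
apply: (@le_lt_trans _ _ ((2 * pi)^-1 * (e4 * (2 * pi) + M * I1 + (e4 * (2 * pi) + M * I2)))).
  rewrite ler_wpM2l ?invr_ge0 ?(ltW p0)// (le_trans (cmod_le_ReIm _))//.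
  apply: lerD.
    apply: le_trans (b1 _) => [|x].
      rewrite le_eqVlt; apply/orP; left; apply/eqP; congr (`| _ |).
      by apply: eq_Rintegral => x _; rewrite Re_realM.
    by have [h|h] := dich x; [left; exact: le_lt_trans (Re_le_cmod _) h|right].
  apply: le_trans (b2 _) => [|x].
    rewrite le_eqVlt; apply/orP; left; apply/eqP; congr (`| _ |).
    by apply: eq_Rintegral => x _; rewrite Im_realM.
  by have [h|h] := dich x; [left; exact: le_lt_trans (Im_le_cmod _) h|right].
have -> : (2 * pi)^-1 * (e4 * (2 * pi) + M * I1 + (e4 * (2 * pi) + M * I2)) =
   e / 2 + C / N%:R.
  rewrite /C /M /e4; move: (gt_eqF p0); generalize (2 * pi : R) => p /negbT p1.
  by field; rewrite pnatr_eq0 -lt0n N0 (gt_eqF d0) p1.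
by rewrite [ltRHS](splitr e) ltrD2l.
Unshelve. all: by end_near. Qed.

End Fejer.

(** * Averages over k-th roots *)

Section Roots.
Context {R : realType}.
Variables (k : nat) (k0 : (0 < k)%N).
Implicit Types (y w : R[i]).

Definition circle_roots y : set R[i] := [set w | circle w /\ w ^+ k = y].

Lemma uniq_roots_size y (r : seq R[i]) : uniq r ->
  {in r, forall w, w ^+ k = y} -> (size r <= k)%N.
Proof.
move=> ur rk; have := @max_poly_roots _ ('X^k - y%:P) r.
rewrite size_XnsubC// ltnS; apply => //.
  by rewrite -size_poly_eq0 size_XnsubC.
by apply/allP => w /rk wk; rewrite rootE !hornerE wk subrr.
Qed.

Lemma finite_circle_roots y : finite_set (circle_roots y).
Proof.
apply: contrapT => /(@infinite_set_fset _ _ k.+1)[X XS].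
apply/negP; rewrite -leqNgt.
by apply: (@uniq_roots_size y); [exact: fset_uniq|move=> w /XS[]].
Qed.

(** Modulo [2 pi] the angle is [2 t] with [0 < t < pi], and
    [cos (2 t) = 1 - 2 (sin t)^2 < 1]. *)
Lemma expi_neq1 (m : int) : ~~ (k %| m)%Z ->
  expi (m%:~R * (2 * pi / k%:R)) != 1 :> R[i].
Proof.
move=> km; have kz : k%:Z != 0 by rewrite eqz_nat -lt0n.
have : ~~ (m %% k == 0)%Z by apply: contraNN km => /eqP/dvdz_mod0P.
have := modz_ge0 m kz; have := @ltz_pmod m k; rewrite ltz_nat => /(_ k0).
rewrite {4}(divz_eq m k); case: (m %% k)%Z => // n; rewrite ltz_nat eqz_nat => nk _ n0.
have kR : k%:R != 0 :> R by rewrite pnatr_eq0 -lt0n.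
rewrite (_ : _ * _ = (m %/ k)%Z%:~R * (2 * pi) + (n%:R * pi / k%:R) *+ 2); last first.
  rewrite rmorphD rmorphM/= -!pmulrn mulrDl; congr (_ + _).
    by rewrite -mulrA; congr (_ * _); rewrite mulrCA divff// mulr1.
  by rewrite -[RHS]mulr_natl; ring.
rewrite expiD (_ : expi (_ * (2 * pi)) = 1); last first.
  by rewrite /expi cos_intmul_2pi sin_intmul_2pi.
rewrite mul1r eq_complex/= negb_and cos_mulr2n; apply/orP; left.
have : 0 < sin (n%:R * pi / k%:R) :> R.
  apply: sin_gt0_pi; rewrite divr_gt0 ?ltr0n ?mulr_gt0 ?pi_gt0 ?ltr0n ?lt0n//=.
  by rewrite ltr_pdivrMr ?ltr0n// mulrC ltr_pM2l ?pi_gt0// ltr_nat.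
have := sin2cos2 (n%:R * pi / k%:R : R); set c := cos _; set t := sin _ => tc t0.
apply/eqP => c1; have : 0 < t ^+ 2 by rewrite exprn_gt0.
rewrite tc; lra.
Qed.

(** Multiplication by [e^(2 pi i / k)] permutes the roots and multiplies every
    term, hence the sum, by a number which differs from [1]. *)
Lemma sum_circle_roots_eq0 y (j l : nat) : ~~ (k %| j%:Z - l%:Z)%Z ->
  \sum_(w \in circle_roots y) (w ^+ j * (w^*) ^+ l) = 0.
Proof.
move=> kjl; pose a : R := 2 * pi / k%:R; pose S := circle_roots y.
have kR : k%:R != 0 :> R by rewrite pnatr_eq0 -lt0n.
have ak : expi a ^+ k = 1.
  rewrite -expi_natmul /a mulrCA divff// mulr1.
  by rewrite -[_ * pi]mul1r (_ : 1 = 1%:~R)// /expi cos_intmul_2pi sin_intmul_2pi.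
have aNa : expi a * expi (- a) = 1 by rewrite -expiD subrr expi0.
have bij : set_bij S S ( *%R (expi a)).
  split.
  - move=> w /= [/circleP w1 wk]; split; last by rewrite exprMn ak mul1r.
    by apply/circleP; rewrite cmodM cmod_expi w1 mulr1.
  - by move=> v w _ _ /(congr1 ( *%R (expi (- a)))); rewrite !mulrA -!expiD addNr expi0 !mul1r.
  - move=> w /= [/circleP w1 wk]; exists (expi (- a) * w); last by rewrite mulrA aNa mul1r.
    split; first by apply/circleP; rewrite cmodM cmod_expi w1 mulr1.
    by rewrite exprMn wk -[LHS]mul1r -{1}ak mulrA -exprMn aNa expr1n mul1r.
set f := fun w : R[i] => w ^+ j * (w^*) ^+ l.
have fa w : f (expi a * w) = expi ((j%:Z - l%:Z)%:~R * a) * f w.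
  rewrite /f rmorphM/= !exprMn mulrACA; congr (_ * _).
  rewrite [X in _ * X ^+ _](_ : _ = expi (- a)); last first.
    by apply/eqP; rewrite eq_complex /= cosN sinN !eqxx.
  by rewrite -!expi_natmul -expiD; congr expi; rewrite rmorphB/= -!pmulrn; ring.
have : \sum_(w \in S) f (expi a * w) = \sum_(w \in S) f w.
  by apply/esym; exact: reindex_fsbig bij.
under eq_fsbigr do rewrite fa.
rewrite -mulr_fsumr => /eqP; rewrite -subr_eq0 -{2}[\sum_(_ \in _) _]mul1r -mulrBl.
by rewrite mulf_eq0 subr_eq0 (negPf (expi_neq1 kjl)) => /eqP.
Qed.

End Roots.

Section DeltaBound.
Context {R : realType}.
Variables (k : nat) (k0 : (0 < k)%N).
Implicit Types (y w : R[i]) (F : R[i] -> R[i]).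

Lemma DeltaE F y :
  Delta k F y = k%:R^-1 * \sum_(w <- fset_set (circle_roots k y)) F w.
Proof. by rewrite /Delta fsbig_finite//; exact: finite_circle_roots. Qed.

Lemma mem_circle_roots y w : w \in fset_set (circle_roots k y) ->
  circle w /\ w ^+ k = y.
Proof. by rewrite in_fset_set ?inE//; exact: finite_circle_roots. Qed.

Lemma cmodVn (n : nat) : cmod (n%:R^-1 : R[i]) = n%:R^-1.
Proof. by rewrite -(rmorph_nat (real_complex R)) -fmorphV cmod_real ger0_norm. Qed.

Lemma cmod_Delta_le F y (b : R) : 0 <= b ->
  (forall w, circle w -> w ^+ k = y -> cmod (F w) <= b) ->
  cmod (Delta k F y) <= b.
Proof.
move=> b0 Fb; have kR : (0 : R) < k%:R by rewrite ltr0n.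
rewrite DeltaE cmodM cmodVn mulrC ler_pdivrMr// (le_trans (cmod_sum _ _ _))//.
rewrite big_seq (le_trans (ler_sum _ (F := _) (G := fun=> b) _))//.
  by move=> w /mem_circle_roots[]; exact: Fb.
rewrite -big_seq big_const_seq count_predT iter_addr_0 -[b *+ _]mulr_natr ler_wpM2l// ler_nat.
apply: (@uniq_roots_size _ _ k0 y); first exact: fset_uniq.
by move=> w /mem_circle_roots[].
Qed.

Lemma DeltaB F G y : Delta k F y - Delta k G y = Delta k (fun w => F w - G w) y.
Proof. by rewrite !DeltaE -mulrBr sumrB. Qed.

(** On the circle [w^j (w^* )^l] is [w^(j-l)]. *)
Lemma Delta_monomial_le y (j l : nat) :
  cmod (Delta k (fun w => w ^+ j * (w^*) ^+ l) y) <= (k %| j%:Z - l%:Z)%Z%:R.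
Proof.
have [_|kjl] := boolP (k %| j%:Z - l%:Z)%Z.
  apply: cmod_Delta_le => // w /circleP w1 _.
  by rewrite cmodM !cmodX cmodJ w1 !expr1n mulr1.
rewrite /Delta (_ : \sum_(_ \in _) _ = 0) ?mulr0.
  by rewrite /cmod /= !expr0n addr0 sqrtr0.
exact: sum_circle_roots_eq0.
Qed.

Lemma Delta_fejer_meanE N F y :
  Delta k (fejer_mean N F) y = N%:R^-1 * \sum_(j < N) \sum_(l < N)
     Delta k (fun w => w ^+ j * (w^*) ^+ l) y * fourier_coef F (j%:Z - l%:Z).
Proof.
rewrite DeltaE -mulr_sumr mulrCA; congr (_ * _).
rewrite exchange_big mulr_sumr; apply: eq_bigr => j _ /=.
rewrite exchange_big mulr_sumr; apply: eq_bigr => l _ /=.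
by rewrite DeltaE -mulrA -mulr_suml.
Qed.

Definition nonzero_multiples : set int := [set m | m != 0 /\ (k %| m)%Z].

(** For each of the [N] values of [l], the differences [j - l] are pairwise
    distinct, and only those which are nonzero multiples of [k] contribute. *)
Lemma cmod_Delta_fejer_le N F y (b : R) : (0 < N)%N -> fourier_coef F 0 = 0 ->
  (\esum_(m in nonzero_multiples) (cmod (fourier_coef F m))%:E <= b%:E)%E ->
  cmod (Delta k (fejer_mean N F) y) <= b.
Proof.
move=> N0 c0 Bb; have NR : (0 : R) < N%:R by rewrite ltr0n.
rewrite Delta_fejer_meanE cmodM cmodVn mulrC ler_pdivrMr// exchange_big/=.
rewrite (le_trans (cmod_sum _ _ _))//.
rewrite (le_trans (ler_sum _ (F := _) (G := fun=> b) _))//; last first.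
  by rewrite sumr_const card_ord mulr_natr.
move=> l _; rewrite (le_trans (cmod_sum _ _ _))// -lee_fin (le_trans _ Bb)//.
pose P (j : 'I_N) := (j%:Z - l%:Z != 0) && (k %| j%:Z - l%:Z)%Z.
pose r := [seq (j%:Z - l%:Z) | j : 'I_N <- enum P].
have ur : uniq r.
  rewrite map_inj_uniq ?enum_uniq// => i j /addIr/eqP.
  by rewrite eqz_nat => /eqP/val_inj.
have rI : {in r, forall m, nonzero_multiples m}.
  by move=> m /mapP[j]; rewrite mem_enum => /andP[? ?] ->.
apply: le_trans (sum_le_esum _ ur rI).
rewrite big_map big_enum sumEFin lee_fin [leRHS]big_mkcond.
apply: ler_sum => j _; rewrite cmodM unfold_in /P.
have cz : j%:Z - l%:Z = 0 -> cmod (fourier_coef F (j%:Z - l%:Z)) = 0.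
  by move=> ->; rewrite c0 /cmod/= !expr0n addr0 sqrtr0.
have := Delta_monomial_le y j l; have := cmod_ge0 (fourier_coef F (j%:Z - l%:Z)).
move: (cmod (Delta _ _ _)) (cmod (fourier_coef _ _)) cz => D c cz c_ge0.
have [jl _|jl] := eqVneq (j%:Z - l%:Z) 0; first by rewrite cz// mulr0.
case: (k %| _)%Z => /= h; first by rewrite (le_trans (ler_wpM2r c_ge0 h))// mul1r.
by rewrite (le_trans (ler_wpM2r c_ge0 h))// mul0r.
Qed.

(** [Delta] involves finitely many values of [F], so the Fejer means converge
    uniformly on them and the bound passes to the limit. *)
Lemma cmod_Delta_le_esum F y (b : R) : {within circle, continuous F} ->
  fourier_coef F 0 = 0 ->
  (\esum_(m in nonzero_multiples) (cmod (fourier_coef F m))%:E <= b%:E)%E ->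
  cmod (Delta k F y) <= b.
Proof.
move=> cF c0 Bb; apply/ler_addgt0Pr => e e0.
have near_seq (r : seq R[i]) : {in r, forall w, circle w} ->
    \forall N \near \oo, forall w, w \in r -> cmod (fejer_mean N F w - F w) < e.
  elim: r => [|w r IH] rc; first by near=> N => w; rewrite in_nil.
  have h1 := fejer_cvg cF (rc w (mem_head _ _)) e0.
  have h2 := IH (fun v vr => rc v (@mem_behead _ (w :: r) v vr)).
  near=> N => v; rewrite in_cons => /predU1P[->|]; first by near: N.
  by move: v; near: N.
near \oo => N.
have N0 : (0 < N)%N by near: N; exact: nbhs_infty_gt.
have FN : forall w, w \in fset_set (circle_roots k y) -> cmod (fejer_mean N F w - F w) < e.
  by near: N; apply: near_seq => w /mem_circle_roots[].
rewrite -[Delta k F y](subrK (Delta k (fejer_mean N F) y)) addrC.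
rewrite (le_trans (cmodD _ _))// lerD//; first exact: cmod_Delta_fejer_le.
rewrite DeltaB; apply: cmod_Delta_le => [|w cw wk]; first exact: ltW.
rewrite cmodB ltW// FN// in_fset_set ?inE//; exact: finite_circle_roots.
Unshelve. all: by end_near. Qed.

End DeltaBound.

Import HBNNSimple.

Section Expectation.
Context {R : realType} d (T : measurableType d) (P : probability T R).
Local Open Scope ereal_scope.

(** The integral of a nonnegative function is a supremum over simple functions
    below it, whose values are at most [b] when those of [f] are. *)
Lemma expectation_le_bound (f : T -> R) (b : R) : (forall t, 0 <= f t)%R ->
  (forall t, f t <= b)%R -> 'E_P[f] <= b%:E.
Proof.
move=> f0 fb; rewrite unlock ge0_integralTE => [|t]; last by rewrite lee_fin.
apply: ge_ereal_sup => _ [h /= hf <-].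
rewrite -[X in sintegral _ X](patch_setT (fun=> 0%R)) -integral_nnsfun//.
rewrite (@le_trans _ _ (\int[P]_x (cst b%:E x)))//; last first.
  by rewrite integral_cst//= [X in _ * X]probability_setT mule1.
apply: ge0_le_integral => //.
- by move=> x _; rewrite lee_fin; exact: fun_ge0.
- exact/measurable_EFinP.
- by move=> x _; rewrite (le_trans (hf x))// lee_fin.
Qed.

End Expectation.

(** * Summation of the Fourier coefficients *)

Section Sobolev.
Context {R : realType}.
Variables (s : R) (c : int -> R).
Hypothesis cs : (\esum_(m in [set: int])
  ((`|m|%:~R `^ (2 * s) * c m ^+ 2)%:E) < +oo)%E.

(** Cauchy-Schwarz in the form [u v <= u^2 + v^2], applied to
    [u = |m|^s c_m] and [v = |m|^(a-s) d_m]. *)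
Lemma sobolev_weighted_lty (a : R) (d : nat -> R) :
  (\esum_(n in [set: nat]) (n%:R `^ (- (2 * (s - a))) * d n ^+ 2)%:E < +oo)%E ->
  (\esum_(m in [set m : int | m != 0%R]) ((d `|m|%N * `|m|%:~R `^ a * c m)%:E) < +oo)%E.
Proof.
move=> ds.
have u0 (n : nat) : (0 <= (n%:R `^ (- (2 * (s - a))) * d n ^+ 2)%:E)%E.
  by rewrite lee_fin mulr_ge0 ?powR_ge0 ?sqr_ge0.
have /(lte_add_pinfty cs) := esum_int_absz_lty u0 ds.
rewrite -esumD; last 2 first.
- by move=> m _; rewrite lee_fin mulr_ge0 ?powR_ge0 ?sqr_ge0.
- by move=> m _; exact: u0.
apply: le_lt_trans; apply: le_trans (le_esum_subset _ (@subsetT _ _)).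
apply: le_esum => m /= m0; rewrite -EFinD lee_fin -natr_absz.
have : (0 : R) < `|m|%N%:R by rewrite ltr0n absz_gt0.
move: (`|m|%N%:R : R) => x x0.
have -> : x `^ (2 * s) * c m ^+ 2 = (x `^ s * c m) ^+ 2.
  rewrite exprMn; congr (_ * _).
  by rewrite -powR_mulrn ?powR_ge0// -powRrM mulrC.
have -> : x `^ (- (2 * (s - a))) * d `|m|%N ^+ 2 = (x `^ (a - s) * d `|m|%N) ^+ 2.
  rewrite exprMn; congr (_ * _).
  by rewrite -powR_mulrn ?powR_ge0// -powRrM; congr (_ `^ _); ring.
have -> : x `^ a = x `^ s * x `^ (a - s).
  by rewrite -powRD ?subrKC// (gt_eqF x0) implybT.
move: (x `^ s) (x `^ (a - s)) => u v.
rewrite (_ : _ * _ * _ = (u * c m) * (v * d `|m|%N)); last by ring.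
move: (u * _) (v * _) => {}u {}v.
rewrite -subr_ge0 (_ : _ - _ = (u - v / 2) ^+ 2 + 3 / 4 * v ^+ 2); last by field.
by rewrite addr_ge0 ?sqr_ge0// mulr_ge0 ?sqr_ge0.
Qed.

End Sobolev.

Section DivisorSum.
Context {R : realType}.
Local Open Scope ereal_scope.

(** After exchanging the sums, [m] is hit by the divisors [k] of [|m|], for
    which [k^b <= |m|^b]. *)
Lemma esum_multiples_le (b : R) (c : int -> R) : (0 <= b)%R -> (forall m, 0 <= c m)%R ->
  \esum_(k in [set k : nat | (0 < k)%N])
    \esum_(m in nonzero_multiples k) (k%:R `^ b * c m)%:E <=
  \esum_(m in [set m : int | m != 0%R])
    ((size (divisors `|m|%N))%:R * `|m|%:~R `^ b * c m)%:E.
Proof.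
move=> b0 c0.
have t0 (k : nat) m : 0 <= (k%:R `^ b * c m)%:E by rewrite lee_fin mulr_ge0 ?powR_ge0.
rewrite esum_esum; last by move=> *; exact: t0.
pose Q : set (int * nat) := [set m : int | m != 0%R] `*``
  (fun m => [set` divisors `|m|%N]).
have bij : set_bij Q ([set k : nat | (0 < k)%N] `*`` nonzero_multiples)
    (fun x => (x.2, x.1)).
  split.
  - move=> [m k] [/= m0]; rewrite /= -dvdn_divisors ?absz_gt0// => km.
    by split=> //=; rewrite (dvdn_gt0 _ km)// absz_gt0.
  - by move=> [m k] [m' k'] _ _ /= [-> ->].
  - move=> [k m] [/= k0 [/= m0 km]]; exists (m, k) => //; split => //=.
    by rewrite -dvdn_divisors// absz_gt0.
rewrite (reindex_esum _ _ _ _ bij)/=.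
rewrite -(@esum_esum _ _ _ _ (fun m : int => [set` divisors `|m|%N])
  (fun m (k : nat) => (k%:R `^ b * c m)%:E)); last by move=> *; exact: t0.
apply: le_esum => m /= m0.
rewrite esum_seq ?divisors_uniq// sumEFin lee_fin -mulr_suml ler_wpM2r//.
rewrite -natr_absz mulr_natl.
rewrite -[X in (_ <= _ *+ X)%R]count_predT -iter_addr_0 -big_const_seq big_seq [leRHS]big_seq.
apply: ler_sum => k; rewrite -dvdn_divisors ?absz_gt0// => km.
by rewrite ge0_ler_powR ?nnegrE ?ler_nat// dvdn_leq// absz_gt0.
Qed.

End DivisorSum.

Section Summability.
Context {R : realType}.
Variables (beta s : R) (F : R[i] -> R[i]).
Hypotheses (b0 : 0 <= beta) (bs : 1 / 2 + beta < s).
Hypothesis Fs : (\esum_(m in [set: int])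
  ((`|m|%:~R `^ (2 * s) * cmod (fourier_coef F m) ^+ 2)%:E) < +oo)%E.
Let c m := cmod (fourier_coef F m).

Lemma sobolev_absolute_summability :
  exists2 alpha : R, beta < alpha &
     (\esum_(m in [set: int])
        ((`|m|%:~R `^ alpha * cmod (fourier_coef F m))%:E) < +oo)%E.
Proof.
(* the midpoint of the admissible interval between [beta] and [s - 1 / 2] *)
pose alpha := (beta + s - 1 / 2) / 2.
have a0 : beta < alpha by move: bs; rewrite /alpha; lra.
exists alpha => //.
have Z : (\esum_(n in [set: nat])
    (n%:R `^ (- (2 * (s - alpha))) * 1 ^+ 2)%:E < +oo :> \bar R)%E.
  under eq_esum do rewrite expr1n mulr1.
  by apply: esum_zeta_lty; move: bs; rewrite /alpha; lra.
apply: le_lt_trans (sobolev_weighted_lty Fs (d := fun=> 1) Z).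
rewrite [leRHS]esum_mkcond; apply: le_esum => m _.
case: ifPn => [_|]; first by rewrite mul1r.
rewrite notin_setE/= => /negP; rewrite negbK => /eqP ->.
by rewrite normr0 powR0 ?mul0r// gt_eqF// (le_lt_trans b0).
Qed.

(** The bound of [cmod_Delta_le_esum] is uniform over all points, so it passes
    to the expectation; the sum over [k] of these bounds is controlled by
    [esum_multiples_le]. *)
Lemma Delta_series_summability : {within circle, continuous F} ->
  fourier_coef F 0 = 0 ->
  forall (d' : measure_display) (T' : measurableType d')
    (P' : probability T' R) (Z : nat -> T' -> R[i]),
  (\sum_(1 <= k <oo)
     ((k%:R `^ beta)%:E * 'E_P'[fun t => cmod (Delta k F (Z k t))]) < +oo)%E.
Proof.
move=> cF c0 d' T' P' Z.
have S : (\esum_(k in [set k : nat | (0 < k)%N])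
    \esum_(m in nonzero_multiples k) (k%:R `^ beta * c m)%:E < +oo)%E.
  apply: (le_lt_trans (esum_multiples_le b0 (fun m => cmod_ge0 _))).
  apply: (@sobolev_weighted_lty _ s c Fs beta
    (fun n => (size (divisors n))%:R)).
  by apply: esum_divisors_sqr_lty; move: bs; lra.
apply: le_lt_trans S; apply: lime_le.
  apply: is_cvg_nneseries => k _ _.
  by rewrite mule_ge0 ?lee_fin ?powR_ge0// expectation_ge0// => t; exact: cmod_ge0.
apply: nearW => n; apply: (le_trans _ (sum_le_esum _ (iota_uniq 1 (n - 1)) _)); last first.
  by move=> k; rewrite mem_iota => /andP[].
rewrite [leLHS]big_seq [leRHS]big_seq.
apply: lee_sum => k; rewrite mem_index_iota => /andP[k0 _].
have kb0 : 0 < k%:R `^ beta by rewrite powR_gt0// ltr0n.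
set S := (\esum_(m in _) _)%E.
(* the bound on [Delta] is stated for a real number *)
have [Soo|Sfin] := eqVneq S +oo%E; first by rewrite Soo leey.
have S0 : (0 <= S)%E by apply: esum_ge0 => m _; rewrite lee_fin mulr_ge0 ?powR_ge0 ?cmod_ge0.
have {Sfin} : S \is a fin_num by rewrite ge0_fin_numE// ltey.
move=> /fineK SE; rewrite -SE; set b := fine S.
have cb : (\esum_(m in nonzero_multiples k) (c m)%:E <= ((k%:R `^ beta)^-1 * b)%:E)%E.
  have -> : (\esum_(m in nonzero_multiples k) (c m)%:E =
      \esum_(m in nonzero_multiples k) ((k%:R `^ beta)^-1%:E * (k%:R `^ beta * c m)%:E))%E.
    by apply: eq_esum => m _; rewrite -EFinM mulKf// gt_eqF.
  rewrite EFinM SE; apply: le_esumZl; first by rewrite invr_ge0 ltW.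
  by move=> m; rewrite lee_fin mulr_ge0 ?powR_ge0 ?cmod_ge0.
have -> : b%:E = ((k%:R `^ beta)%:E * ((k%:R `^ beta)^-1 * b)%:E)%E.
  by rewrite -EFinM mulVKf// gt_eqF.
rewrite lee_wpmul2l ?lee_fin ?powR_ge0//.
apply: expectation_le_bound => t; first exact: cmod_ge0.
exact: cmod_Delta_le_esum.
Qed.

End Summability.

Unset Implicit Arguments.

(* The variables [z_j], j >= 1, are [z 0], [z 1], ... here.  The variables
   [Z_{k,1}] may live on another probability space than the [z_j]; [Z 0] is
   unused. *)
Theorem corollary5p7 (R : realType) (theta : R) (F : R[i] -> R[i]) :
  0 <= theta ->
  {within circle, continuous F} ->
  (exists2 s : R, 1 / 2 + Num.max (1 - theta) 0 < s & in_sobolev s F) ->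
  (exists2 alpha : R, Num.max (1 - theta) 0 < alpha &
     (\esum_(m in [set: int])
        ((`|m|%:~R `^ alpha * cmod (fourier_coef F m))%:E) < +oo)%E) /\
  (fourier_coef F 0 = 0 ->
   forall (d : measure_display) (T : measurableType d) (P : probability T R)
          (z : nat -> {RV P >-> borelC R})
          (d' : measure_display) (T' : measurableType d')
          (P' : probability T' R) (Z : nat -> {RV P' >-> borelC R}),
     (forall j, circle_valued (z j)) ->
     iid z ->
     (forall k, circle_valued (Z k)) ->
     (forall k, (1 <= k)%N ->
        eq_in_law P' P (Z k)
          (fun t => (\prod_(j < k) (z j t : R[i])) : borelC R)) ->
     (\sum_(1 <= k <oo)
        ((k%:R `^ Num.max (1 - theta) 0)%:E *
         'E_P'[fun t => cmod (Delta k F (Z k t))]) < +oo)%E).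
Proof.
move=> _ cF [s bs [_ Fs]].
have b0 : 0 <= Num.max (1 - theta) 0 by rewrite le_max lexx orbT.
split; first exact: sobolev_absolute_summability bs Fs.
move=> c0 d T P z d' T' P' Z _ _ _ _.
exact: (Delta_series_summability b0 bs Fs cF c0 P' (fun k t => Z k t)).
Qed.
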